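(* Let $u$ be a uniformly recurrent aperiodic infinite word. Then the window complexity function $n\mapsto P^w_u(n)$ of $u$ is unbounded.
   Context: An infinite word is a sequence $u=u_0u_1u_2\cdots$ of letters from a finite alphabet. A factor of $u$ is a finite block of consecutive letters of $u$. The word $u$ is uniformly recurrent if for every $n\in\mathbb{N}$ there exists $N\in\mathbb{N}$ such that every factor of $u$ of length $N$ contains all factors of $u$ of length $n$. It is aperiodic if it is not eventually periodic, i.e. not of the form $wvvv\cdots$ with $w,v$ finite words and $v$ non-empty. The window complexity function is $P^w_u(n)=\#\{u_{kn}u_{kn+1}\cdots u_{(k+1)n-1}: k\ge 0\}$. *)

(* Defs.v *)
From mathcomp Require Import all_boot.
From mathcomp Require Import boolp.

Set Implicit Arguments.
Unset Strict Implicit.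
Unset Printing Implicit Defensive.

Definition block (A : Type) (u : nat -> A) (i n : nat) : n.-tuple A :=
  [tuple u (i + j) | j < n].

Definition factor (A : Type) (u : nat -> A) (w : seq A) : Prop :=
  exists i, w = block u i (size w).

Definition uniformly_recurrent (A : eqType) (u : nat -> A) : Prop :=
  forall n, exists N, forall v, factor u v -> size v = N ->
    forall w, factor u w -> size w = n -> infix w v.

(* u = w v v v ...  is expressed by: for every k, w followed by k copies
   of v is a prefix of u. *)
Definition eventually_periodic (A : Type) (u : nat -> A) : Prop :=
  exists w v : seq A, v <> [::] /\
    forall k, let p := w ++ flatten (nseq k v) in p = block u 0 (size p).

Definition aperiodic (A : Type) (u : nat -> A) : Prop :=
  ~ eventually_periodic u.

Definition window_complexity (A : finType) (u : nat -> A) (n : nat) : nat :=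
  #|[set w : n.-tuple A | `[< exists k, w = block u (k * n) n >]]|.

Definition unbounded (f : nat -> nat) : Prop := forall M, exists n, M < f n.

(* Main.v *)
(* If P^w_u <= M, compare the windows of lengths n and n+1 for large n. The
   k-th window of length n+1 starts at kn+k, hence at offset k in the
   concatenation of the windows k and k+1 of length n. Among k = 0, ..., M^3,
   two values k < k' give the same three windows: one word of length n+1 then
   sits at offsets k and k' of one word of length 2n, so it has period
   k'-k <= M^3, hence period Q = (M^3)!. Thus u has arbitrarily long factors of
   period Q, and by uniform recurrence u itself has period Q. *)
Require Import Defs.
From mathcomp Require Import all_boot.
From mathcomp Require Import boolp zify.

Set Implicit Arguments.
Unset Strict Implicit.
Unset Printing Implicit Defensive.

Lemma block_inj (A : Type) (u : nat -> A) i j n t :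
  block u i n = block u j n -> t < n -> u (i + t) = u (j + t).
Proof.
move=> e lt_tn.
by have := congr1 (fun w => tnth w (Ordinal lt_tn)) e; rewrite !tnth_mktuple.
Qed.

Lemma nth_block (A : Type) (x0 : A) (u : nat -> A) i n t :
  t < n -> nth x0 (block u i n) t = u (i + t).
Proof.
by move=> lt_tn; rewrite -(tnth_nth x0 _ (Ordinal lt_tn)) tnth_mktuple.
Qed.

Lemma factor_block (A : Type) (u : nat -> A) i n : factor u (block u i n).
Proof. by exists i; rewrite size_tuple. Qed.

Lemma block_cat (A : Type) (u : nat -> A) i m n :
  block u i (m + n) = block u i m ++ block u (i + m) n :> seq A.
Proof.
apply: (@eq_from_nth _ (u 0)) => [|t]; first by rewrite size_cat !size_tuple.
rewrite size_tuple => lt_t; rewrite nth_cat size_tuple nth_block //.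
case: ltnP => [lt_tm|le_mt]; first by rewrite nth_block.
by rewrite nth_block ?ltn_subLR // -addnA subnKC.
Qed.

Lemma periodic_eventually_periodic (A : Type) (u : nat -> A) q :
  0 < q -> (forall j, u (j + q) = u j) -> eventually_periodic u.
Proof.
move=> q_gt0 per; exists [::], (block u 0 q); split.
  by move/(congr1 size); rewrite size_tuple /= => q0; rewrite q0 in q_gt0.
have perM k j : u (j + k * q) = u j.
  by elim: k => [|k IHk]; rewrite ?addn0 // mulSnr addnA per.
have powE k : flatten (nseq k (block u 0 q : seq A)) = block u 0 (k * q) :> seq A.
  elim: k => [|k IHk]; first by apply/esym/size0nil; rewrite size_tuple.
  rewrite mulSn block_cat -[LHS]/(_ ++ flatten (nseq k _)) IHk; congr (_ ++ _).
  apply: (@eq_from_nth _ (u 0)) => [|t]; rewrite !size_tuple // => lt_t.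
  by rewrite !nth_block // add0n -[in RHS]addnC per.
by move=> k /=; rewrite powE size_tuple.
Qed.

(** The factor of length [q.+1] at [j] recurs inside a stretch where shifting by [q] changes
    nothing, so its first and last letters, [u j] and [u (j + q)], agree. *)
Lemma uniformly_recurrent_periodic (A : eqType) (u : nat -> A) q :
    uniformly_recurrent u ->
    (forall n, exists i, forall x, x < n -> u (i + x + q) = u (i + x)) ->
  forall j, u (j + q) = u j.
Proof.
move=> u_rec long_per j.
have [N recN] := u_rec q.+1; have [i per_i] := long_per N.
have /infixP [s1 [s2 e]] := recN _ (factor_block u i N) (size_tuple _)
  _ (factor_block u j q.+1) (size_tuple _).
have szE : N = size s1 + (q.+1 + size s2).
  by have := congr1 size e; rewrite !size_cat !size_tuple.
have letterE t : t < q.+1 -> u (j + t) = u (i + size s1 + t).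
  move=> lt_t; have := congr1 (nth (u 0) ^~ (size s1 + t)) e.
  rewrite nth_block ?addnA; last by lia.
  by rewrite nth_cat ltnNge leq_addr addKn nth_cat size_tuple lt_t nth_block.
by rewrite letterE // -[in RHS](addn0 j) letterE // addn0 per_i //; lia.
Qed.

Lemma mem_window (A : finType) (u : nat -> A) n k :
  block u (k * n) n \in [set w : n.-tuple A | `[< exists k, w = block u (k * n) n >]].
Proof. by rewrite inE; apply/asboolP; exists k. Qed.

(** Pigeonhole on [(M ^ 3).+1] indices: each of the three windows attached to an index takes at most
    [M] values. *)
Lemma repeated_windows (A : finType) (u : nat -> A) M n :
    (forall m, window_complexity u m <= M) ->
  exists k k', [/\ k < k' <= M ^ 3, block u (k * n) n = block u (k' * n) n,
    block u (k.+1 * n) n = block u (k'.+1 * n) n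
    & block u (k * n.+1) n.+1 = block u (k' * n.+1) n.+1].
Proof.
move=> bounded.
pose S m := [set w : m.-tuple A | `[< exists k, w = block u (k * m) m >]].
pose f (k : 'I_(M ^ 3).+1) :=
  (block u (k * n) n, block u (k.+1 * n) n, block u (k * n.+1) n.+1).
have /injectivePn [k [k' ne_kk' eq_f]] : ~~ injectiveb f.
  apply/injectiveP => f_inj.
  suff: (M ^ 3).+1 <= M ^ 3 by rewrite ltnn.
  rewrite -[X in X <= _]card_ord -(card_imset _ f_inj).
  apply: (@leq_trans #|setX (setX (S n) (S n)) (S n.+1)|).
    apply/subset_leq_card/subsetP => _ /imsetP [k _ ->].
    by rewrite !in_setX !mem_window.
  by rewrite !cardsX expnSr -mulnn !leq_mul ?bounded.
have e1 := congr1 (fun t => t.1.1) eq_f.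
have e2 := congr1 (fun t => t.1.2) eq_f.
have e3 := congr1 snd eq_f.
have lt_k (i : 'I_(M ^ 3).+1) : i <= M ^ 3 by rewrite -ltnS.
case: (ltngtP k k') => [lt_kk'|lt_k'k|/val_inj eq_kk'].
- by exists k, k'; rewrite lt_kk' lt_k.
- by exists k', k; rewrite lt_k'k lt_k.
- by rewrite eq_kk' eqxx in ne_kk'.
Qed.

Lemma short_period (A : finType) (u : nat -> A) M n :
    (forall m, window_complexity u m <= M) -> M ^ 3 < n ->
  exists i d, 0 < d <= M ^ 3 /\ forall x, x <= n -> u (i + x + d) = u (i + x).
Proof.
move=> bounded lt_Mn.
have [k [k' [/andP [lt_kk' le_k'M] e1 e2 e3]]] := repeated_windows n bounded.
(* Windows [k] and [k.+1] of length [n] are adjacent, so [e1] and [e2] together equate two stretches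
   of length [n + n]. *)
have pairE o : o < n + n -> u (k * n + o) = u (k' * n + o).
  case: (ltnP o n) => [lt_on _|le_no lt_o]; first exact: block_inj e1 lt_on.
  have lt_on : o - n < n by lia.
  by have := block_inj e2 lt_on; rewrite !mulSnr -!addnA subnKC.
exists (k * n + k), (k' - k); split=> [|x le_xn]; first by lia.
have := block_inj e3 le_xn; rewrite !mulnS => eW.
(* The offset [k' + x] stays below [n + n] because [k' <= M ^ 3 < n]. So [pairE] passes to the
   stretch at [k' * n], and [eW] leads back through the windows of length [n.+1]. *)
have -> : k * n + k + x + (k' - k) = k * n + (k' + x) by lia.
by rewrite pairE ?[k * n + k]addnC ?eW; [congr u|]; lia.
Qed.

(** Each of the [m] shifts by [d] must start where the period is known, which costs [m * d]
    positions. *)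
Lemma multiple_period (A : Type) (u : nat -> A) i d m n :
    (forall x, x < n + m * d -> u (i + x + d) = u (i + x)) ->
  forall x, x < n -> u (i + x + m * d) = u (i + x).
Proof.
elim: m => [|m IHm] per x lt_xn; first by rewrite addn0.
rewrite mulSnr addnA -(addnA i) per; last by lia.
by rewrite addnA IHm // => y lt_y; apply: per; lia.
Qed.

Theorem corollary9p1 (A : finType) (u : nat -> A)
    (u_rec : uniformly_recurrent u) (u_aper : aperiodic u) :
  unbounded (window_complexity u).
Proof.
move=> M; apply: contrapT => not_gt.
have bounded n : window_complexity u n <= M.
  by rewrite leqNgt; apply/negP => gtM; apply: not_gt; exists n.
(* The period [d] found below may vary with [n]; the factorial is a multiple of every possible [d],
   hence a single period for all [n]. *)
apply: u_aper; apply: (@periodic_eventually_periodic _ _ (M ^ 3)`!).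
  exact: fact_gt0.
apply: uniformly_recurrent_periodic => // n.
(* The first two summands are the range [n + m * d] that [multiple_period] consumes; the last one
   makes the length exceed [M ^ 3]. *)
have lt_M : M ^ 3 < n + (M ^ 3)`! + (M ^ 3).+1 by lia.
have [i [d [d_bnd per]]] := short_period bounded lt_M.
have /dvdnP [m Qmd] := dvdn_fact d_bnd.
exists i => x lt_xn; rewrite Qmd; apply: multiple_period lt_xn => y lt_y.
by apply: per; lia.
Qed.
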